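(* Let $X=\mathbb T^2=\mathbb R^2/\mathbb Z^2$ with Haar measure $\mu$, and let $\rho_t(v)=tv$ for $v\in\mathbb R^2$, $t\in\mathbb R$. There exists a function $\phi\colon(0,1)\to\mathbb R^2$ such that for every $x_0\in\mathbb T^2$, the family of measures $(\mu_t)_{t\ge0}$ defined by $\int_Xf\,d\mu_t=\int_0^1 f(t\phi(u)+x_0)\,du$ for $f\in C(X)$ is weakly equidistributed but not equidistributed on $X$.
   Context: A family $(\mu_t)_{t\ge0}$ of probability measures on $X$ is equidistributed if $\int f\,d\mu_t\to\int f\,d\mu$ as $t\to\infty$ for all $f\in C(X)$; it is weakly equidistributed if there is a set $A\subset[0,\infty)$ with $\lim_{T\to\infty}\lambda(A\cap[0,T])/T=1$ ($\lambda$ Lebesgue measure) such that $\int f\,d\mu_t\to\int f\,d\mu$ as $t\to\infty$ with $t\in A$, for all $f\in C(X)$. *)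

(* Defs.v *)
From HB Require Import structures.
From mathcomp Require Import all_boot all_order all_algebra.
From mathcomp Require Import all_classical all_reals all_analysis.
Set Implicit Arguments. Unset Strict Implicit. Unset Printing Implicit Defensive.
Import Order.TTheory GRing.Theory Num.Theory.
Import numFieldNormedType.Exports.
Local Open Scope classical_set_scope.
Local Open Scope ring_scope.

(* The torus T^2 = R^2/Z^2 is modelled via Z^2-periodic functions on R^2 = R*R.
   C(T^2) = continuous real functions on R*R, 1-periodic in each coordinate. *)
Definition torus_fun (R : realType) (f : R * R -> R) : Prop :=
  continuous f /\
  forall x : R * R, f (x.1 + 1, x.2) = f x /\ f (x.1, x.2 + 1) = f x.

(* integral of f against Haar measure on T^2: Lebesgue (product) measure on the
   fundamental domain [0,1[ x [0,1[ *)
Definition haar_int (R : realType) (f : R * R -> R) : R :=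
  Rintegral ((@lebesgue_measure R) \x (@lebesgue_measure R))%E
            (`[0, 1[ `*` `[0, 1[) f.

Definition mu_t_int (R : realType) (phi : R -> R * R) (x0 : R * R)
    (t : R) (f : R * R -> R) : R :=
  Rintegral (@lebesgue_measure R) `]0, 1[
    (fun u => f (t * (phi u).1 + x0.1, t * (phi u).2 + x0.2)).

Definition cvg_along (R : realType) (A : set R) (g : R -> R) (l : R) : Prop :=
  forall e : R, 0 < e -> exists M : R, forall t, A t -> M <= t -> `|g t - l| < e.

Definition equidistributed (R : realType) (phi : R -> R * R) (x0 : R * R) : Prop :=
  forall f, torus_fun f ->
    cvg_along `[0, +oo[ (fun t => mu_t_int phi x0 t f) (haar_int f).

Definition weakly_equidistributed (R : realType) (phi : R -> R * R) (x0 : R * R)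
  : Prop :=
  exists A : set R,
    [/\ measurable A, A `<=` `[0, +oo[,
        fine (@lebesgue_measure R (A `&` `[0, T])) / T @[T --> +oo] --> (1 : R)
      & forall f, torus_fun f ->
          cvg_along A (fun t => mu_t_int phi x0 t f) (haar_int f)].

(* Main.v *)
(* Take [phi u = (c u, pi * c u)] with [c u = \sum_k floor(2^k u) / q_k], where
   [q_k] divides [q_(k+1)] and [q_(k+1) / q_k] grows so fast that [q_k * c u] is
   always within 1/8 of an integer.  At the times [t = q_k] the character
   [e(x_1)] thus has integral bounded away from 0 against [mu_t], so there is no
   equidistribution.  On the other hand [c] is strictly increasing, with the
   explicit modulus [2^-k <= v - u -> 1 / q_k <= c v - c u]; its distribution
   has no atoms, and Wiener's argument (average [|\int e(s c u) du|^2] over [s]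
   by Fubini) shows that its Fourier transform is small outside a set of density
   zero.  As [pi] is irrational, every nontrivial character of the torus restricts
   to a nontrivial character along [phi], so their integrals tend to 0 along a common
   set of density one, obtained by a diagonal argument.  General continuous
   functions are reached by a discrete Fejer approximation, with sums over a
   finite grid in place of a convolution. *)
Require Import Defs.
From HB Require Import structures.
From mathcomp Require Import all_boot all_order all_algebra.
From mathcomp Require Import all_classical all_reals all_analysis.
From mathcomp Require Import measurable_realfun ring lra.
Set Implicit Arguments. Unset Strict Implicit. Unset Printing Implicit Defensive.
Import Order.TTheory GRing.Theory Num.Theory.
Import numFieldNormedType.Exports.
Local Open Scope classical_set_scope.
Local Open Scope ring_scope.

(** * Bounded integrands, Fubini on rectangles, and the integral of a cosine *)

Section integrals.
Context {R : realType}.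
Notation lam := (@lebesgue_measure R).

Lemma bounded_integrable d (T : measurableType d)
    (m : {measure set T -> \bar R}) (D : set T) (f : T -> R) (M : R) :
  measurable D -> (m D < +oo)%E -> measurable_fun D f ->
  (forall x, D x -> `|f x| <= M) -> m.-integrable D (EFin \o f).
Proof.
move=> mD fD mf fM; apply: measurable_bounded_integrable => //.
exists M; split; first exact: num_real.
by move=> x /ltW Mx y Dy; exact: le_trans (fM _ Dy) Mx.
Qed.

Lemma Rintegral_le_bound d (T : measurableType d)
    (m : {measure set T -> \bar R}) (D : set T) (f : T -> R) (M : R) :
  measurable D -> (m D < +oo)%E -> measurable_fun D f ->
  (forall x, D x -> `|f x| <= M) -> `|\int[m]_(x in D) f x| <= M * fine (m D).
Proof.
move=> mD fD mf fM; rewrite -Rintegral_cst//.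
apply: le_trans (le_normr_Rintegral mD (bounded_integrable mD fD mf fM)) _.
apply: le_Rintegral => //.
- apply: (@bounded_integrable _ _ m D _ M) => //; last first.
    by move=> x Dx; rewrite normr_id; exact: fM.
  exact: measurableT_comp.
- apply: (@bounded_integrable _ _ m D _ `|M|) => //.
Qed.

Section fubini.
Context d1 d2 (T1 : measurableType d1) (T2 : measurableType d2).
Variables (m1 : {sigma_finite_measure set T1 -> \bar R}).
Variables (m2 : {sigma_finite_measure set T2 -> \bar R}).
Variables (D1 : set T1) (D2 : set T2) (f : T1 * T2 -> R) (M : R).
Hypotheses (mD1 : measurable D1) (mD2 : measurable D2).
Hypotheses (fD1 : (m1 D1 < +oo)%E) (fD2 : (m2 D2 < +oo)%E).
Hypotheses (mf : measurable_fun setT f) (fM : forall z, `|f z| <= M).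

(** Extension by zero outside the rectangle: Fubini on the whole product then yields the iterated
    integrals over [D1] and [D2]. *)
Let g : T1 * T2 -> \bar R := (EFin \o f) \_ (D1 `*` D2).

Let gE1 x : (fun y => g (x, y)) =
  if x \in D1 then (fun y => (f (x, y))%:E) \_ D2 else cst 0%E.
Proof.
apply/funext => y; rewrite /g patchE/= in_setX/=.
by case: (x \in D1) => /=; rewrite ?patchE//; case: ifP.
Qed.

Let gE2 y : (fun x => g (x, y)) =
  if y \in D2 then (fun x => (f (x, y))%:E) \_ D1 else cst 0%E.
Proof.
apply/funext => x; rewrite /g patchE/= in_setX/= andbC.
by case: (y \in D2) => /=; rewrite ?patchE//; case: ifP.
Qed.

Let mD : measurable (D1 `*` D2). Proof. exact: measurableX. Qed.

Let fD : ((m1 \x m2) (D1 `*` D2) < +oo)%E.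
Proof. by rewrite product_measure1E//= lte_mul_pinfty// ?ge0_fin_numE. Qed.

Lemma integrable_rectangle : (m1 \x m2)%E.-integrable (D1 `*` D2) (EFin \o f).
Proof.
apply: (@bounded_integrable _ _ (m1 \x m2)%E (D1 `*` D2) f M) => //.
exact: measurable_funTS.
Qed.

Let ig : (m1 \x m2)%E.-integrable setT g.
Proof. by rewrite /g -integrable_mkcond//; exact: integrable_rectangle. Qed.

Let fin1 x : (\int[m2]_(y in D2) (f (x, y))%:E)%E \is a fin_num.
Proof.
apply: integrable_fin_num => //.
apply: (@bounded_integrable _ _ m2 D2 (fun y => f (x, y)) M) => //.
by apply: measurable_funTS; apply: measurableT_comp => //; exact: pair1_measurable.
Qed.

Let fin2 y : (\int[m1]_(x in D1) (f (x, y))%:E)%E \is a fin_num.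
Proof.
apply: integrable_fin_num => //.
apply: (@bounded_integrable _ _ m1 D1 (fun x => f (x, y)) M) => //.
by apply: measurable_funTS; apply: measurableT_comp => //; exact: pair2_measurable.
Qed.

Let int1 x : (\int[m2]_y g (x, y))%E =
  ((fun x => (\int[m2]_(y in D2) f (x, y))%:E) \_ D1) x.
Proof.
rewrite (gE1 x) patchE; case: ifP => xD; last by rewrite integral_cst// mul0e.
by rewrite -integral_mkcond /Rintegral fineK.
Qed.

Let int2 y : (\int[m1]_x g (x, y))%E =
  ((fun y => (\int[m1]_(x in D1) f (x, y))%:E) \_ D2) y.
Proof.
rewrite (gE2 y) patchE; case: ifP => yD; last by rewrite integral_cst// mul0e.
by rewrite -integral_mkcond /Rintegral fineK.
Qed.

Lemma Rintegral_rectangle :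
  \int[(m1 \x m2)%E]_(z in D1 `*` D2) f z
  = \int[m1]_(x in D1) \int[m2]_(y in D2) f (x, y).
Proof.
rewrite /Rintegral integral_mkcond -/g -(integral12_prod_meas1 ig).
congr fine; rewrite [RHS]integral_mkcond; apply: eq_integral => x _.
by rewrite /fubini_F int1.
Qed.

Lemma Rintegral_rectangle_swap :
  \int[m1]_(x in D1) \int[m2]_(y in D2) f (x, y)
  = \int[m2]_(y in D2) \int[m1]_(x in D1) f (x, y).
Proof.
rewrite -Rintegral_rectangle.
rewrite /Rintegral integral_mkcond -/g -(integral21_prod_meas1 ig).
congr fine; rewrite [RHS]integral_mkcond; apply: eq_integral => x _.
by rewrite /fubini_G int2.
Qed.

Lemma measurable_Rintegral_section :
  measurable_fun D1 (fun x => \int[m2]_(y in D2) f (x, y)).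
Proof.
apply/measurable_EFinP; rewrite measurable_restrictT//.
apply: eq_measurable_fun (measurable_fubini_F ig) => x _.
by rewrite /fubini_F int1.
Qed.

End fubini.

Lemma Rintegral_cos (a b th : R) : a != 0 -> 0 < b ->
  \int[lam]_(t in `[0, b]) cos (a * t + th) = (sin (a * b + th) - sin th) / a.
Proof.
move=> a0 b0.
have c1 (h : R -> R) : continuous h -> continuous (fun t => h (a * t + th)).
  move=> ch t; apply: (@continuous_comp _ _ _ (fun t => a * t + th) h); last exact: ch.
  by apply: cvgD; [apply: cvgMr; exact: cvg_id|exact: cvg_cst].
have cF : continuous (fun t => sin (a * t + th) / a).
  move=> t; apply: cvgMl; apply: c1; exact: continuous_sin.
have dF (t : R) : is_derive t (1 : R) (fun t : R => sin (a * t + th) / a) (cos (a * t + th)).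
  apply: is_derive_eq.
  rewrite /GRing.scale /= !mulr0 !addr0 !mulr1 !add0r.
  by field.
rewrite /Rintegral (@continuous_FTC2 _ _ (fun t => sin (a * t + th) / a))//=.
- by rewrite mulr0 add0r mulrBl.
- by apply: continuous_subspaceT; apply: c1; exact: continuous_cos.
- split.
  + by move=> x _; case: (dF x).
  + exact/cvg_at_right_filter/cF.
  + exact/cvg_at_left_filter/cF.
- by move=> x _; rewrite derive1E; exact: (@derive_val _ _ _ _ _ _ _ (dF x)).
Qed.

End integrals.

(** * The strictly increasing function [c] built from binary digits *)

Section digit_map.
Context {R : realType}.
Implicit Types (u v : R) (n k : nat).

Fixpoint scale_seq n : nat :=
  if n is m.+1 then (scale_seq m * 2 ^ (m + 5))%N else 1%N.

Arguments scale_seq : simpl never.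

Definition digit_sum n u : R :=
  \sum_(k < n.+1) (Num.truncn (2 ^+ k * u))%:R / (scale_seq k)%:R.

(* The clamp [Num.min u 1] keeps the partial sums bounded, so that the supremum is
   meaningful and [digit_map] is monotone on the whole line. *)
Definition digit_map u : R := sup (range (fun n => digit_sum n (Num.min u 1))).

Local Notation q n := ((scale_seq n)%:R : R).

Lemma scale_seq_gt0 n : 0 < q n.
Proof. by rewrite ltr0n; elim: n => //= n IH; rewrite /scale_seq muln_gt0 IH expn_gt0. Qed.

Let q_gt0 := scale_seq_gt0.

Lemma scale_seqS n : q n.+1 = q n * 2 ^+ (n + 5).
Proof. by rewrite /scale_seq -/scale_seq natrM natrX. Qed.

Lemma scale_seq_ge n : n%:R <= q n.
Proof.
rewrite ler_nat; elim: n => //= n IH.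
rewrite /scale_seq -/scale_seq (leq_trans (ltn_expl n (isT : 1 < 2)%N))//.
apply: (@leq_trans (2 ^ (n + 5))); first by rewrite leq_exp2l// leq_addr.
by rewrite leq_pmull// -(ltr_nat R) q_gt0.
Qed.

Lemma digit_sumS n u : digit_sum n.+1 u =
  digit_sum n u + (Num.truncn (2 ^+ n.+1 * u))%:R / q n.+1.
Proof. by rewrite /digit_sum big_ord_recr. Qed.

Lemma digit_sum_incr n u : digit_sum n u <= digit_sum n.+1 u.
Proof. by rewrite digit_sumS lerDl divr_ge0// ltW. Qed.

Lemma digit_sum_mono n m u : (n <= m)%N -> digit_sum n u <= digit_sum m u.
Proof.
move=> /subnK <-; elim: (m - n)%N => [|j IH]; first by rewrite add0n.
by rewrite addSn (le_trans IH)// digit_sum_incr.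
Qed.

Lemma digit_sum_nd n : {homo digit_sum n : u v / u <= v}.
Proof.
move=> u v uv; apply: ler_sum => k _.
by rewrite ler_pM2r ?invr_gt0// ler_nat le_truncn// ler_pM2l// exprn_gt0.
Qed.

(* The factor [2 ^ (n + 5)] in [scale_seq] makes [digit_sum n u + (8 * q n)^-1] a
   nonincreasing sequence, which bounds the remainder of the series. *)
Lemma digit_sum_tail n u : u <= 1 ->
  digit_sum n.+1 u + (8 * q n.+1)^-1 <= digit_sum n u + (8 * q n)^-1.
Proof.
move=> u1; rewrite digit_sumS -addrA lerD2l.
have /= tr : (Num.truncn (2 ^+ n.+1 * u))%:R <= 2 ^+ n.+1 :> R.
  rewrite -natrX ler_nat truncn_le_nat natrX.
  rewrite (@le_lt_trans _ _ (2 ^+ n.+1))//; last by rewrite -natrX ltr_nat.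
  by rewrite ler_piMr// exprn_ge0.
have e2 : (1 : R) <= 2 ^+ n by rewrite exprn_ege1// ler1n.
have qn := q_gt0 n.
apply: (@le_trans _ _ (2 ^+ n.+1 / q n.+1 + (8 * q n.+1)^-1)).
  by rewrite lerD2r ler_pM2r// invr_gt0 q_gt0.
rewrite scale_seqS exprD exprS.
set a := 2 ^+ n in e2 *; set b := q n in qn *.
have a0 : 0 < a by lra.
rewrite -subr_ge0.
have -> : (8 * b)^-1 - (2 * a / (b * (a * 2 ^+ 5)) + (8 * (b * (a * 2 ^+ 5)))^-1)
  = (16 * a - 1) / (256 * a * b) by field; lra.
by apply: divr_ge0; [lra|rewrite !mulr_ge0// ltW].
Qed.

Lemma digit_sum_ub n m u : u <= 1 -> digit_sum m u <= digit_sum n u + (8 * q n)^-1.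
Proof.
move=> u1; have p k : 0 <= (8 * q k)^-1 by rewrite invr_ge0 mulr_ge0// ltW.
have [mn|nm] := leqP m n.
  by rewrite (le_trans (digit_sum_mono _ mn))// lerDl.
apply: (@le_trans _ _ (digit_sum m u + (8 * q m)^-1)); first by rewrite lerDl.
move: nm => /ltnW/subnK <-; elim: (m - n)%N => [//|j IH].
exact: le_trans (digit_sum_tail _ u1) IH.
Qed.

Lemma digit_map_ge n u : u <= 1 -> digit_sum n u <= digit_map u.
Proof.
move=> u1; rewrite /digit_map (min_idPl u1); apply: ub_le_sup; last by exists n.
by exists (digit_sum 0 u + (8 * q 0)^-1) => _ [m _ <-]; exact: digit_sum_ub.
Qed.

Lemma digit_map_le a u : u <= 1 -> (forall n, digit_sum n u <= a) -> digit_map u <= a.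
Proof.
move=> u1 ua; rewrite /digit_map (min_idPl u1); apply: ge_sup.
  by exists (digit_sum 0 u), 0%N.
by move=> _ [m _ <-].
Qed.

Lemma digit_map_nd : nondecreasing_fun digit_map.
Proof.
move=> u v uv.
(* Both arguments may be clamped at 1, where the bounds on partial sums apply. *)
have E w : digit_map w = digit_map (Num.min w 1).
  by rewrite /digit_map [Num.min (Num.min _ _) _]min_l// ge_min lexx orbT.
rewrite (E u) (E v).
have u1 : Num.min u 1 <= 1 by rewrite ge_min lexx orbT.
have v1 : Num.min v 1 <= 1 by rewrite ge_min lexx orbT.
apply: digit_map_le => // n; apply: le_trans (digit_map_ge n v1).
apply: digit_sum_nd.
by rewrite le_min ge_min uv/= ge_min lexx orbT.
Qed.

Lemma measurable_digit_map : measurable_fun setT digit_map.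
Proof. exact: nondecreasing_measurable digit_map_nd. Qed.

(** A gap of [2 ^- k] raises the term [floor(2^k u)] by at least one, and every other term of the
    series is nondecreasing in [u]. *)
Lemma digit_map_sep k u v : 0 <= u -> v <= 1 -> 2 ^- k <= v - u ->
  (q k)^-1 <= digit_map v - digit_map u.
Proof.
move=> u0 v1 uv.
have k0 : 0 < 2 ^- k :> R by rewrite invr_gt0 exprn_gt0.
have u1 : u <= 1 by lra.
rewrite lerBrDr addrC -lerBrDr; apply: digit_map_le => // n.
(* Passing to [maxn n k] guarantees that the partial sum contains the term of index [k]. *)
rewrite lerBrDr; apply: le_trans (digit_map_ge (maxn n k) v1).
apply: (@le_trans _ _ (digit_sum (maxn n k) u + (q k)^-1)).
  by rewrite lerD2r digit_sum_mono// leq_maxl.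
have kn : (k < (maxn n k).+1)%N by rewrite ltnS leq_maxr.
rewrite /digit_sum (bigD1 (Ordinal kn))//= [leRHS](bigD1 (Ordinal kn))//=.
rewrite addrAC lerD//; last first.
  apply: ler_sum => i _.
  rewrite ler_pM2r ?invr_gt0// ler_nat; apply: le_truncn.
  by apply: ler_wpM2l; rewrite ?exprn_ge0//; lra.
rewrite -[X in _ + X]mul1r -mulrDl ler_pM2r ?invr_gt0// natr1 ler_nat.
have e0 : 0 < 2 ^+ k :> R by rewrite exprn_gt0.
have uvk : 1 <= 2 ^+ k * v - 2 ^+ k * u.
  by rewrite -mulrBr -ler_pdivrMl// mulr1.
rewrite truncn_ge_nat; last by rewrite mulr_ge0 ?ltW//; lra.
rewrite -natr1.
have : (Num.truncn (2 ^+ k * u))%:R <= 2 ^+ k * u.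
  by rewrite truncn_le mulr_ge0// ltW.
lra.
Qed.

Lemma scale_digit_sum_nat n u : exists m : nat, q n * digit_sum n u = m%:R.
Proof.
elim: n => [|n [m IH]].
  by rewrite /digit_sum big_ord_recr big_ord0/= divr1 mul1r add0r; eexists.
rewrite digit_sumS mulrDr [_ * (_ / _)]mulrCA mulfV ?mulr1 ?gt_eqF//.
rewrite scale_seqS mulrAC IH -natrX -natrM -natrD; by eexists.
Qed.

(** [q n] clears every denominator of the partial sum up to [n], and the remainder of the series is
    at most [1 / (8 q n)]. *)
Lemma scale_digit_map n u : u <= 1 ->
  exists2 m : nat, 0 <= q n * digit_map u - m%:R & q n * digit_map u - m%:R <= 8^-1.
Proof.
move=> u1; have [m mE] := scale_digit_sum_nat n u; exists m; rewrite -mE -mulrBr.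
  by rewrite mulr_ge0 ?(ltW (q_gt0 n))// subr_ge0 digit_map_ge.
rewrite -ler_pdivlMl//.
rewrite lerBlDl; apply: digit_map_le => // k.
by rewrite -invfM mulrC digit_sum_ub.
Qed.

End digit_map.

(** * Wiener's mean square estimate for the Fourier transform of [c] *)

Section mean_square.
Context {R : realType}.
Notation lam := (@lebesgue_measure R).
Variable c : R -> R.
Hypothesis mc : measurable_fun setT c.

(** Real and imaginary parts, at [s], of the Fourier transform of the distribution of [c] under the
    uniform law on the unit interval. *)
Definition char_cos (s : R) : R := \int[lam]_(u in `]0, 1[) cos (s * c u).
Definition char_sin (s : R) : R := \int[lam]_(u in `]0, 1[) sin (s * c u).

Lemma integrable_scale d (T : measurableType d) (m : {measure set T -> \bar R})
    (D : set T) (a : R) (f : T -> R) : measurable D ->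
  m.-integrable D (EFin \o f) -> m.-integrable D (EFin \o (fun x => a * f x)).
Proof. by move=> mD intf; exact: (integrableZl mD a intf). Qed.

Lemma measurable_cos : measurable_fun [set: R] (@cos R).
Proof. by apply: continuous_measurable_fun; exact: continuous_cos. Qed.

Lemma measurable_sin : measurable_fun [set: R] (@sin R).
Proof. by apply: continuous_measurable_fun; exact: continuous_sin. Qed.

Let lamU : lam `]0, 1[ = 1%E.
Proof. by rewrite lebesgue_measure_itv/= lte_fin ltr01 -EFinB subr0. Qed.

Let fU : (lam `]0%R, 1%R[ < +oo)%E.
Proof. by rewrite lamU ltry. Qed.

Let lamI (T : R) : 0 < T -> lam `[0, T] = T%:E.
Proof. by move=> T0; rewrite lebesgue_measure_itv/= lte_fin T0 -EFinB subr0. Qed.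

Let fI (T : R) : 0 < T -> (lam `[0%R, T] < +oo)%E.
Proof. by move=> T0; rewrite lamI// ltry. Qed.

Lemma measurable_cos_mulr (g : R) : measurable_fun setT (fun u => cos (g * c u)).
Proof.
apply: measurableT_comp; [exact: measurable_cos|exact: measurable_funM].
Qed.

Lemma measurable_sin_mulr (g : R) : measurable_fun setT (fun u => sin (g * c u)).
Proof.
apply: measurableT_comp; [exact: measurable_sin|exact: measurable_funM].
Qed.

Let mprod (g : R) : measurable_fun setT (fun z : R * R => g * z.1 * c z.2).
Proof.
apply: measurable_funM; first exact: measurable_funM.
exact: measurableT_comp.
Qed.

(* A Dirac mass is a finite measure for which the whole line is a legitimate
   domain of the outer variable. *)
Lemma measurable_char_cos : measurable_fun setT char_cos.
Proof.
apply: (@measurable_Rintegral_section R _ _ _ _ (\d_ (0:R)) lam setT `]0, 1[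
  (fun z => cos (z.1 * c z.2)) 1) => //.
- by rewrite /= diracT ltry.
- apply: measurableT_comp; first exact: measurable_cos.
  by apply: eq_measurable_fun (mprod 1) => z _; rewrite mul1r.
- by move=> z; exact: cos_max.
Qed.

Lemma measurable_char_sin : measurable_fun setT char_sin.
Proof.
apply: (@measurable_Rintegral_section R _ _ _ _ (\d_ (0:R)) lam setT `]0, 1[
  (fun z => sin (z.1 * c z.2)) 1) => //.
- by rewrite /= diracT ltry.
- apply: measurableT_comp; first exact: measurable_sin.
  by apply: eq_measurable_fun (mprod 1) => z _; rewrite mul1r.
- by move=> z; exact: sin_max.
Qed.

Lemma char_cos_le1 s : `|char_cos s| <= 1.
Proof.
rewrite -[leRHS]mulr1 -[X in _ * X]/(fine 1%E) -lamU.
apply: Rintegral_le_bound => //; last by move=> *; exact: cos_max.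
exact: measurable_funTS (measurable_cos_mulr s).
Qed.

Lemma char_sin_le1 s : `|char_sin s| <= 1.
Proof.
rewrite -[leRHS]mulr1 -[X in _ * X]/(fine 1%E) -lamU.
apply: Rintegral_le_bound => //; last by move=> *; exact: sin_max.
exact: measurable_funTS (measurable_sin_mulr s).
Qed.

Let iU (f : R -> R) (M : R) : measurable_fun setT f -> (forall x, `|f x| <= M) ->
  lam.-integrable `]0, 1[ (EFin \o f).
Proof.
move=> mf fM; apply: (@bounded_integrable R _ _ lam `]0, 1[ f M) => //.
exact: measurable_funTS.
Qed.

Lemma integrable_cos_mulr (s : R) : lam.-integrable `]0, 1[ (EFin \o (fun u => cos (s * c u))).
Proof. by apply: (iU (M := 1)) => [|x]; [exact: measurable_cos_mulr|exact: cos_max]. Qed.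

Lemma integrable_sin_mulr (s : R) : lam.-integrable `]0, 1[ (EFin \o (fun u => sin (s * c u))).
Proof. by apply: (iU (M := 1)) => [|x]; [exact: measurable_sin_mulr|exact: sin_max]. Qed.

Lemma Rintegral_lin_cos_sin (a b s : R) :
  \int[lam]_(u in `]0, 1[) (a * cos (s * c u) + b * sin (s * c u))
  = a * char_cos s + b * char_sin s.
Proof.
rewrite RintegralD//=; first by rewrite !RintegralZl//;
  [exact: integrable_sin_mulr|exact: integrable_cos_mulr].
- by apply: integrable_scale => //; exact: integrable_cos_mulr.
- by apply: integrable_scale => //; exact: integrable_sin_mulr.
Qed.

Lemma Rintegral_cos_phase (s th : R) :
  \int[lam]_(u in `]0, 1[) cos (s * c u + th)
  = cos th * char_cos s - sin th * char_sin s.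
Proof.
rewrite -mulNr -Rintegral_lin_cos_sin; apply: eq_Rintegral => u _.
rewrite cosD; ring.
Qed.

Let kernel_bound (a T : R) : 0 < T -> `|\int[lam]_(t in `[0, T]) cos (a * t)| <= T.
Proof.
move=> T0; rewrite -[leRHS]mul1r -[X in _ * X]/(fine T%:E) -lamI//.
apply: Rintegral_le_bound; rewrite ?fI//; last by move=> *; exact: cos_max.
apply: measurable_funTS; apply: measurableT_comp; first exact: measurable_cos.
exact: measurable_funM.
Qed.

Let kernel_decay (a T : R) : 0 < T -> a != 0 ->
  `|\int[lam]_(t in `[0, T]) cos (a * t)| <= 2 / `|a|.
Proof.
move=> T0 a0; under eq_Rintegral => t _ do rewrite -[a * t]addr0.
rewrite Rintegral_cos// sin0 subr0 normrM normfV ler_pM2r ?invr_gt0 ?normr_gt0//.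
by rewrite (le_trans (sin_max _))// ler1n.
Qed.

(* Wiener's argument: [C^2 + S^2] at [g * t] is the double integral over [u] and [v]
   of [cos (g t (c u - c v))], whose average over [t] is small off the diagonal. *)
Lemma mean_square_bound (d h g T : R) : 0 < d -> 0 < h -> g != 0 -> 0 < T ->
  (forall u v : R, 0 < u -> v < 1 -> d <= v - u -> h <= c v - c u) ->
  \int[lam]_(t in `[0, T]) (char_cos (g * t) ^+ 2 + char_sin (g * t) ^+ 2)
  <= 2 * d * T + 2 / (`|g| * h).
Proof.
move=> d0 h0 g0 T0 sep.
have K0 : 0 <= 2 / (`|g| * h).
  by rewrite divr_ge0// mulr_ge0// ltW.
have mgt : measurable_fun [set: R * R] (fun z : R * R => g * z.1) by exact: measurable_funM.
have mF : measurable_fun [set: R * R] (fun z : R * R =>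
    char_cos (g * z.1) * cos (g * z.1 * c z.2) +
    char_sin (g * z.1) * sin (g * z.1 * c z.2)).
  apply: measurable_funD; apply: measurable_funM.
  - by apply: measurableT_comp => //; exact: measurable_char_cos.
  - by apply: measurableT_comp => //; exact: measurable_cos.
  - by apply: measurableT_comp => //; exact: measurable_char_sin.
  - by apply: measurableT_comp => //; exact: measurable_sin.
have mG v : measurable_fun [set: R * R] (fun z : R * R => cos (g * (c z.2 - c v) * z.1)).
  apply: measurableT_comp; first exact: measurable_cos.
  apply: measurable_funM => //; apply: measurable_funM => //.
  by apply: measurable_funB => //; exact: measurableT_comp.
have mG' v : measurable_fun [set: R * R] (fun z : R * R => cos (g * (c z.1 - c v) * z.2)).
  apply: measurableT_comp; first exact: measurable_cos.
  apply: measurable_funM => //; apply: measurable_funM => //.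
  by apply: measurable_funB => //; exact: measurableT_comp.
have mH : measurable_fun [set: (R * R) * R]
    (fun z : (R * R) * R => cos (g * (c z.1.2 - c z.1.1) * z.2)).
  apply: measurableT_comp; first exact: measurable_cos.
  apply: measurable_funM => //; apply: measurable_funM => //.
  by apply: measurable_funB; do 2 apply: measurableT_comp => //.
(* One factor of each square is expanded as an integral over [v], which is then exchanged with the
   integral over [t]. *)
rewrite (@eq_Rintegral _ _ _ lam _ (fun t : R => \int[lam]_(v in `]0, 1[)
    (char_cos (g * t) * cos (g * t * c v) + char_sin (g * t) * sin (g * t * c v)))); last first.
  by move=> t _; rewrite Rintegral_lin_cos_sin !expr2.
rewrite (@Rintegral_rectangle_swap R _ _ _ _ lam lam `[0, T] `]0, 1[
  (fun z => char_cos (g * z.1) * cos (g * z.1 * c z.2) +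
            char_sin (g * z.1) * sin (g * z.1 * c z.2)) 2)//; [|exact: fI|]; last first.
  move=> z; rewrite (le_trans (ler_normD _ _))// !normrM.
  have -> : 2 = 1 * 1 + 1 * 1 :> R by ring.
  by rewrite lerD// ler_pM// ?char_cos_le1 ?char_sin_le1 ?cos_max ?sin_max.
(* The remaining factor is expanded as an integral over [u]; the subtraction formula for the cosine
   merges the two products into one kernel. *)
have swap v : \int[lam]_(t in `[0, T])
    (char_cos (g * t) * cos (g * t * c v) + char_sin (g * t) * sin (g * t * c v))
  = \int[lam]_(u in `]0, 1[) \int[lam]_(t in `[0, T]) cos (g * (c u - c v) * t).
  rewrite (@eq_Rintegral _ _ _ lam _ (fun t : R => \int[lam]_(u in `]0, 1[)
    cos (g * (c u - c v) * t))); last first.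
    move=> t _; rewrite [LHS](_ : _ = cos (g * t * c v) * char_cos (g * t)
      + sin (g * t * c v) * char_sin (g * t)); last by rewrite mulrC [X in _ + X = _]mulrC.
    rewrite -Rintegral_lin_cos_sin; apply: eq_Rintegral => u _.
    rewrite [_ * cos _]mulrC [_ * sin _]mulrC -cosB; congr cos.
    by rewrite mulrBr mulrBl; congr (_ - _); rewrite mulrAC.
  rewrite (@Rintegral_rectangle_swap R _ _ _ _ lam lam `[0, T] `]0, 1[
    (fun z => cos (g * (c z.2 - c v) * z.1)) 1)//; [exact: fI|exact: mG|].
  by move=> z; exact: cos_max.
have mK (v : R) : measurable_fun (`]0%R, 1%R[%classic : set R)
    (fun u : R => \int[lam]_(t in `[0, T]) cos (g * (c u - c v) * t)).
  apply: (@measurable_Rintegral_section R _ _ _ _ lam lam `]0, 1[ `[0, T]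
    (fun z => cos (g * (c z.1 - c v) * z.2)) 1) => //; [exact: fI| |].
    exact: mG'.
  by move=> z; exact: cos_max.
have inner (v : R) : v \in `]0, 1[%classic ->
    `|\int[lam]_(u in `]0, 1[) \int[lam]_(t in `[0, T]) cos (g * (c u - c v) * t)|
    <= 2 * d * T + 2 / (`|g| * h).
  rewrite inE/= in_itv/= => /andP[v0 v1].
  have iK : lam.-integrable `]0, 1[ (EFin \o
      (fun u => \int[lam]_(t in `[0, T]) cos (g * (c u - c v) * t))).
    apply: (@bounded_integrable R _ _ lam `]0, 1[
      (fun u => \int[lam]_(t in `[0, T]) cos (g * (c u - c v) * t)) T) => //; first exact: mK.
    by move=> u _; exact: kernel_bound.
  apply: (le_trans (le_normr_Rintegral _ iK)) => //.
  have i1 : lam.-integrable `]0, 1[ (EFin \o (\1_(`]v - d, v + d[%classic) : R -> R)).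
    apply: (@iU _ 1); first exact: measurable_indic.
    by move=> u; rewrite indicE; case: (_ \in _); rewrite ?normr0 ?normr1.
  (* Within distance [d] of [v] the kernel is bounded by [T]; farther away the separation of [c]
     gives the decay [2 / (|g| h)]. The strip around [v] has length at most [2 d]. *)
  apply: (@le_trans _ _ (\int[lam]_(u in `]0, 1[)
     (T * \1_(`]v - d, v + d[%classic) u + 2 / (`|g| * h)))).
    apply: le_Rintegral => //.
    - by rewrite (_ : _ \o _ = abse \o (EFin \o
        (fun u => \int[lam]_(t in `[0, T]) cos (g * (c u - c v) * t))))//; exact: integrable_abse.
    - apply: (@integrableD _ _ _ lam `]0, 1[ _ (fun u => (T * \1_(`]v - d, v + d[%classic) u)%:E)
       (cst (2 / (`|g| * h))%:E)) => //; first exact: integrable_scale.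
      by apply: (@iU (cst (2 / (`|g| * h))) `|2 / (`|g| * h)|).
    move=> u; rewrite /= in_itv/= => /andP[u0 u1].
    rewrite indicE; case: (boolP (u \in _)) => [_|].
      by rewrite mulr1 (le_trans (kernel_bound _ T0))// lerDl.
    rewrite notin_setE/= in_itv/= => /negP; rewrite negb_and -!leNgt => uv.
    rewrite mulr0 add0r.
    have hc : h <= `|c u - c v|.
      case/orP: uv => uv; first by rewrite distrC (le_trans _ (ler_norm _))// sep//; lra.
      by rewrite (le_trans _ (ler_norm _))// sep//; lra.
    have cuv : 0 < `|c u - c v| by exact: lt_le_trans hc.
    have cuv0 : c u - c v != 0 by rewrite -normr_gt0.
    have gcuv : g * (c u - c v) != 0 by rewrite mulf_neq0.
    apply: (le_trans (kernel_decay T0 gcuv)).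
    rewrite normrM ler_pM2l// lef_pV2 ?posrE ?mulr_gt0 ?normr_gt0//.
    by rewrite ler_pM2l// normr_gt0.
  rewrite RintegralD//=; [|exact: integrable_scale|]; last first.
    by apply: (@iU (cst (2 / (`|g| * h))) `|2 / (`|g| * h)|).
  rewrite Rintegral_cst// RintegralZl// [fine _](congr1 fine lamU) mulr1 lerD2r.
  rewrite mulrC ler_pM2r// /Rintegral integral_indic//.
  have mE : (lam (`](v - d)%R, (v + d)%R[%classic `&` `]0%R, 1%R[) <= (2 * d)%:E)%E.
    apply: (@le_trans _ _ (lam `](v - d)%R, (v + d)%R[%classic)).
      by apply: le_measure; rewrite ?inE//; exact: measurableI.
    rewrite lebesgue_measure_itv/= lte_fin.
    case: ifP => _; last by rewrite lee_fin mulr_ge0// ltW.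
    by rewrite -EFinB lee_fin; lra.
  rewrite -lee_fin fineK//.
  by rewrite ge0_fin_numE// (le_lt_trans mE)// ltry.
under eq_Rintegral => v _ do rewrite swap.
apply: (le_trans (ler_norm _)).
rewrite -[leRHS]mulr1 -[X in _ * X]/(fine 1%E) -lamU.
apply: Rintegral_le_bound => //; last by move=> v Uv; apply: inner; rewrite inE.
apply: (@measurable_Rintegral_section R _ _ _ _ lam lam `]0, 1[ `]0, 1[
  (fun z => \int[lam]_(t in `[0, T]) cos (g * (c z.2 - c z.1) * t)) T) => //.
  (* Joint measurability in [(u, v)] again uses a Dirac mass, now at the origin of the plane, to
     take the whole plane as outer domain. *)
  apply: (@measurable_Rintegral_section R _ _ _ _ (\d_ ((0, 0) : R * R)) lam setT `[0, T]
    (fun z => cos (g * (c z.1.2 - c z.1.1) * z.2)) 1) => //; [|exact: fI|].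
  - by rewrite /= diracT ltry.
  - by move=> z; exact: cos_max.
by move=> z; exact: kernel_bound.
Qed.

End mean_square.

(** * The algebra of real trigonometric polynomials on the torus *)

Section trigonometric_polynomials.
Context {R : realType}.

(** The free phase [th] covers sines and constants too, so a single family of generators
    suffices. *)
Inductive trig_poly : (R * R -> R) -> Prop :=
| trig_poly_cos (m n : int) (th : R) :
    trig_poly (fun z => cos (2 * pi * (m%:~R * z.1 + n%:~R * z.2) + th))
| trig_polyD f g : trig_poly f -> trig_poly g -> trig_poly (fun z => f z + g z)
| trig_polyZ a f : trig_poly f -> trig_poly (fun z => a * f z).

Lemma trig_poly_ext f g : f =1 g -> trig_poly f -> trig_poly g.
Proof. by move=> /funext ->. Qed.

Lemma trig_poly_cst a : trig_poly (fun=> a).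
Proof.
apply: trig_poly_ext (trig_polyZ a (trig_poly_cos 0 0 0)) => z.
by rewrite !mul0r !addr0 mulr0 cos0 mulr1.
Qed.

Lemma trig_poly_sum I (s : seq I) (F : I -> R * R -> R) :
  (forall i, trig_poly (F i)) -> trig_poly (fun z => \sum_(i <- s) F i z).
Proof.
move=> tF; elim: s => [|i s IH].
  by apply: trig_poly_ext (trig_poly_cst 0) => z; rewrite big_nil.
by apply: trig_poly_ext (trig_polyD (tF i) IH) => z; rewrite big_cons.
Qed.

(** The product-to-sum formula settles two generators; bilinearity does the rest. *)
Lemma trig_polyM f g : trig_poly f -> trig_poly g -> trig_poly (fun z => f z * g z).
Proof.
move=> tf tg; elim: tf => [m n th|f1 f2 _ IH1 _ IH2|a f1 _ IH].
- elim: tg => [m' n' th'|g1 g2 _ IH1 _ IH2|a g1 _ IH].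
  + apply: trig_poly_ext (trig_polyZ 2^-1 (trig_polyD
      (trig_poly_cos (m + m') (n + n') (th + th'))
      (trig_poly_cos (m - m') (n - n') (th - th')))) => z /=.
    set A := 2 * pi * _ + th; set B := 2 * pi * _ + th'.
    rewrite (_ : 2 * pi * _ + (th + th') = A + B); last first.
      by rewrite /A /B !intrD; ring.
    rewrite (_ : 2 * pi * _ + (th - th') = A - B); last first.
      by rewrite /A /B !intrB; ring.
    by rewrite cosD cosB; field.
  + by apply: trig_poly_ext (trig_polyD IH1 IH2) => z; rewrite -mulrDr.
  + by apply: trig_poly_ext (trig_polyZ a IH) => z; rewrite mulrCA.
- by apply: trig_poly_ext (trig_polyD IH1 IH2) => z; rewrite -mulrDl.
- by apply: trig_poly_ext (trig_polyZ a IH) => z; rewrite mulrA.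
Qed.

End trigonometric_polynomials.

(** * The Fejer kernel on a finite grid *)

Section fejer_kernel.
Context {R : realType}.
Implicit Types x y : R.

(** Each summand satisfies [2 sin y cos A = sin (A + y) - sin (A - y)], and consecutive arguments
    [A] differ by [2 y]. *)
Lemma sum_cos_telescope (M : nat) y (th : R) :
  2 * sin y * \sum_(j < M) cos (2 * j%:R * y + th)
  = sin ((2 * M%:R - 1) * y + th) - sin (th - y).
Proof.
elim: M => [|M IH].
  rewrite big_ord0 mulr0 mulr0 sub0r mulN1r [- y + th]addrC; ring.
rewrite big_ord_recr/= mulrDr IH -[M.+1%:R]natr1.
set A := 2 * M%:R * y + th.
rewrite (_ : (2 * M%:R - 1) * y + th = A - y); last by rewrite /A; ring.
rewrite (_ : (2 * (M%:R + 1) - 1) * y + th = A + y); last by rewrite /A; ring.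
by rewrite (sinB A) (sinD A); ring.
Qed.

Lemma cosDint x (m : int) : cos (x + 2 * pi * m%:~R) = cos x.
Proof.
have P (n : nat) y : cos (y + 2 * pi * n%:R) = cos y.
  rewrite -[RHS](periodicn (@cosD2pi R) n); congr cos; ring.
case: m => n; first exact: P.
by rewrite -[LHS](P n.+1) NegzE; congr cos; rewrite rmorphN/=; ring.
Qed.

Lemma sinDint x (m : int) : sin (x + 2 * pi * m%:~R) = sin x.
Proof. by rewrite -cosBpihalf addrAC cosDint cosBpihalf. Qed.

Lemma sin_neq0 x : x != 0 -> `|x| < pi -> sin x != 0.
Proof.
move=> x0 xpi; have [xn|xp] := ltP x 0.
  rewrite -[x]opprK sinN oppr_eq0 gt_eqF// sin_gt0_pi//.
  by rewrite oppr_gt0 xn -ltr0_norm.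
by rewrite gt_eqF// sin_gt0_pi// lt_neqAle eq_sym x0 xp -(ger0_norm xp).
Qed.

(** Discrete orthogonality of characters. The telescoped sum compares two sines whose arguments
    differ by whole periods, while [0 < |j - k| < M] keeps the factor [sin y] nonzero. *)
Lemma sum_cos_grid (M j k : nat) x : (j < M)%N -> (k < M)%N -> j != k ->
  \sum_(a < M) cos (2 * pi * (j%:R - k%:R) * (x - a%:R / M%:R)) = 0.
Proof.
move=> jM kM jk.
have M0 : M%:R != 0 :> R by rewrite pnatr_eq0 -lt0n (leq_ltn_trans _ jM).
have Mp : 0 < M%:R :> R by rewrite ltr0n (leq_ltn_trans _ jM).
pose y : R := - (pi * (j%:R - k%:R) / M%:R).
have y0 : sin y != 0.
  apply: sin_neq0.
    rewrite oppr_eq0 mulf_neq0 ?invr_eq0// mulf_neq0//.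
      by rewrite gt_eqF// pi_gt0.
    by rewrite subr_eq0 eqr_nat.
  rewrite normrN -mulrA normrM gtr0_norm ?pi_gt0// gtr_pMr ?pi_gt0//.
  rewrite normrM normfV (gtr0_norm Mp) ltr_pdivrMr// mul1r.
  have jM' : j%:R < M%:R :> R by rewrite ltr_nat.
  have kM' : k%:R < M%:R :> R by rewrite ltr_nat.
  have j0 : 0 <= j%:R :> R by []. have k0 : 0 <= k%:R :> R by [].
  rewrite ltr_norml; apply/andP; split; lra.
have s0 : 2 * sin y != 0 by rewrite mulf_neq0// pnatr_eq0.
apply: (mulfI s0); rewrite mulr0.
pose th : R := 2 * pi * (j%:R - k%:R) * x.
rewrite (eq_bigr (fun a : 'I_M => cos (2 * a%:R * y + th))); last first.
  by move=> a _; congr cos; rewrite /y /th; field.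
rewrite sum_cos_telescope; apply/eqP; rewrite subr_eq0; apply/eqP.
rewrite -[RHS](sinDint _ (k%:Z - j%:Z)); congr sin.
by rewrite /y intrB; field.
Qed.

(** The squared modulus of the sum of [e(j x)] over [j < M], divided by [M ^ 2] instead of the usual
    [M]: this makes the values over a grid of mesh [1 / M] sum to 1. *)
Definition fejer (M : nat) x : R :=
  ((\sum_(j < M) cos (2 * pi * j%:R * x)) ^+ 2
   + (\sum_(j < M) sin (2 * pi * j%:R * x)) ^+ 2) / M%:R ^+ 2.

Lemma fejer_ge0 M x : 0 <= fejer M x.
Proof. by rewrite divr_ge0 ?addr_ge0 ?sqr_ge0. Qed.

Lemma fejerE M x : fejer M x =
  (\sum_(j < M) \sum_(k < M) cos (2 * pi * (j%:R - k%:R) * x)) / M%:R ^+ 2.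
Proof.
rewrite /fejer !expr2 !big_distrlr/= -big_split/=; congr (_ / _).
apply: eq_bigr => j _; rewrite -big_split/=; apply: eq_bigr => k _.
by rewrite -cosB; congr cos; ring.
Qed.

(** By orthogonality only the [M] diagonal terms [j = k] survive, each contributing [M] over the
    grid. *)
Lemma sum_fejer_grid M x : (0 < M)%N -> \sum_(a < M) fejer M (x - a%:R / M%:R) = 1.
Proof.
move=> M0; have M1 : M%:R != 0 :> R by rewrite pnatr_eq0 -lt0n.
under eq_bigr => a _ do rewrite fejerE.
rewrite -big_distrl/= exchange_big/=.
rewrite (eq_bigr (fun j : 'I_M => M%:R)); last first.
  move=> j _; rewrite exchange_big/= (bigD1 j)//= [X in _ + X]big1.
    rewrite addr0 (eq_bigr (fun=> 1)); last first.
      by move=> a _; rewrite subrr mulr0 mul0r cos0.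
    by rewrite sumr_const card_ord.
  by move=> k kj; rewrite sum_cos_grid// eq_sym.
by rewrite sumr_const card_ord -mulr_natl; field.
Qed.

(** Multiplication by [sin (pi x)] telescopes the geometric sum of the kernel, leaving a quantity of
    modulus at most 1 over [M]. *)
Lemma sin2_fejer M x : (0 < M)%N -> sin (pi * x) ^+ 2 * fejer M x <= (M%:R ^+ 2)^-1.
Proof.
move=> M0; have M1 : 0 < M%:R ^+ 2 :> R by rewrite exprn_gt0// ltr0n.
rewrite /fejer mulrA ler_pdivrMr// mulVf ?gt_eqF//.
set y := pi * x; set C := \sum_(j < M) cos _; set S := \sum_(j < M) sin _.
have HC : 2 * sin y * C = sin ((2 * M%:R - 1) * y) + sin y.
  have := sum_cos_telescope M y 0; rewrite addr0 sub0r sinN opprK => <-.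
  by congr (_ * _); apply: eq_bigr => j _; congr cos; rewrite /y; ring.
have HS : 2 * sin y * S = cos y - cos ((2 * M%:R - 1) * y).
  (* The phase [- pi / 2] turns the cosines into sines. *)
  have := sum_cos_telescope M y (- (pi / 2)).
  rewrite [- (pi / 2) - y]addrC sinBpihalf sinBpihalf cosN.
  rewrite opprK [- _ + _]addrC => <-.
  congr (_ * _); apply: eq_bigr => j _; rewrite -cosBpihalf; congr (cos (_ - _)).
  by rewrite /y; ring.
set a := (2 * M%:R - 1) * y in HC HS.
have E : 4 * (sin y ^+ 2 * (C ^+ 2 + S ^+ 2)) = (sin a + sin y) ^+ 2 + (cos y - cos a) ^+ 2.
  by rewrite -HC -HS; ring.
(* The right side of [E] equals [2 - 2 cos (a + y)], hence is at most 4. *)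
have := cos_geN1 (a + y); rewrite cosD => h.
have := cos2Dsin2 a; have := cos2Dsin2 y; nra.
Qed.

End fejer_kernel.

(** * Uniform approximation of continuous functions on the torus *)

Section torus_approximation.
Context {R : realType}.

Lemma trig_poly_fejer1 M a : trig_poly (fun z : R * R => fejer M (z.1 - a)).
Proof.
apply: (@trig_poly_ext _ (fun z => (M%:R ^+ 2)^-1 *
    (\sum_(j < M) \sum_(k < M) cos (2 * pi * (j%:R - k%:R) * (z.1 - a))))).
  by move=> z; rewrite fejerE mulrC.
apply: trig_polyZ; apply: trig_poly_sum => j; apply: trig_poly_sum => k.
apply: trig_poly_ext (trig_poly_cos (j%:Z - k%:Z) 0 (- (2 * pi * (j%:R - k%:R) * a))) => z.
by congr cos; rewrite intrB; ring.
Qed.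

Lemma trig_poly_fejer2 M a : trig_poly (fun z : R * R => fejer M (z.2 - a)).
Proof.
apply: (@trig_poly_ext _ (fun z => (M%:R ^+ 2)^-1 *
    (\sum_(j < M) \sum_(k < M) cos (2 * pi * (j%:R - k%:R) * (z.2 - a))))).
  by move=> z; rewrite fejerE mulrC.
apply: trig_polyZ; apply: trig_poly_sum => j; apply: trig_poly_sum => k.
apply: trig_poly_ext (trig_poly_cos 0 (j%:Z - k%:Z) (- (2 * pi * (j%:R - k%:R) * a))) => z.
by congr cos; rewrite intrB; ring.
Qed.

Lemma torus_funDint (f : R * R -> R) (m n : int) x y :
  torus_fun f -> f (x + m%:~R, y + n%:~R) = f (x, y).
Proof.
move=> [_ pf].
have P1 (k : nat) u v : f (u + k%:R, v) = f (u, v).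
  elim: k => [|k IH]; first by rewrite addr0.
  by rewrite -natr1 addrA (pf (u + k%:R, v)).1.
have P2 (k : nat) u v : f (u, v + k%:R) = f (u, v).
  elim: k => [|k IH]; first by rewrite addr0.
  by rewrite -natr1 addrA (pf (u, v + k%:R)).2.
have Q1 u v : f (u + m%:~R, v) = f (u, v).
  case: m => k; first exact: P1.
  by rewrite -(P1 k.+1 (u + _)) NegzE rmorphN/= subrK.
have Q2 u v : f (u, v + n%:~R) = f (u, v).
  case: n => k; first exact: P2.
  by rewrite -(P2 k.+1 u (v + _)) NegzE rmorphN/= subrK.
by rewrite Q1 Q2.
Qed.

Let unit_square : set (R * R) := `[0, 1] `*` `[0, 1].

Let compact_square : compact unit_square.
Proof. by apply: compact_setX; exact: segment_compact. Qed.

Lemma torus_fun_bounded (f : R * R -> R) : torus_fun f ->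
  exists2 B : R, 0 <= B & forall z, `|f z| <= B.
Proof.
move=> tf; have cf := tf.1.
have /compact_bounded [B [_ HB]] : compact (f @` unit_square).
  by apply: continuous_compact => //; apply: continuous_subspaceT.
exists (`|B| + 1); first by rewrite addr_ge0.
move=> [x y].
have -> : f (x, y) = f (x + (- Num.floor x)%:~R, y + (- Num.floor y)%:~R).
  by rewrite torus_funDint.
apply: HB; first by rewrite (le_lt_trans (ler_norm _))// ltrDl.
exists (x + (- Num.floor x)%:~R, y + (- Num.floor y)%:~R) => //.
have h (t : R) : 0 <= t + (- Num.floor t)%:~R <= 1.
  have /andP[t1 t2] := floor_itv t; rewrite intrD in t2.
  by rewrite rmorphN/=; apply/andP; split; lra.
by split; rewrite /= in_itv/= h.
Qed.

Lemma torus_fun_unif_continuous (f : R * R -> R) (e : R) : torus_fun f -> 0 < e ->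
  exists2 d : R, 0 < d & forall x y x' y',
    `|x - x'| < d -> `|y - y'| < d -> `|f (x, y) - f (x', y')| <= e.
Proof.
move=> tf e0; have cf := tf.1.
(* The point [w] ranges over the whole plane, so that only [z] has to lie in the unit square. *)
pose P (d : R) (z : R * R) := forall w : R * R,
  `|w.1 - z.1| < d -> `|w.2 - z.2| < d -> `|f w - f z| <= e.
have : \forall d \near 0^'+, unit_square `<=` P d.
  apply: (compact_near_coveringP unit_square).1 => // z _.
  have /cvgrPdist_lt/(_ (e / 2)) := cf z.
  rewrite divr_gt0// => /(_ isT)/nbhs_ballP[h /= h0 hf].
  have h2 : 0 < h / 2 by rewrite divr_gt0.
  exists (ball z (h / 2), [set d | d < h / 2]).
    split; first exact: nbhsx_ballx.
    exact: nbhs_right_lt.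
  move=> [z' d] [/= [/= z1 z2] dh] w w1 w2.
  have H1 : `|f z - f z'| < e / 2.
    by apply: hf; split; apply: le_ball z1 || apply: le_ball z2; lra.
  have H2 : `|f z - f w| < e / 2.
    apply: hf; split; rewrite -ball_normE /ball_/= in z1 z2 *.
      by rewrite (le_lt_trans (ler_distD z'.1 _ _))// [`|z'.1 - _|]distrC; lra.
    by rewrite (le_lt_trans (ler_distD z'.2 _ _))// [`|z'.2 - _|]distrC; lra.
  by rewrite (le_trans (ler_distD (f z) _ _))// [`|f w - _|]distrC; lra.
move=> nearP; have : \forall d \near 0^'+, 0 < d /\ unit_square `<=` P d.
  by near=> d; split; near: d => //; exact: nbhs_right_gt.
move=> /filter_ex[d [d0 Pd]]; exists d => // x y x' y' xd yd.
(* Both points are translated by the same integers, which brings the second one into the square and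
   preserves their differences. *)
rewrite -(torus_funDint (- Num.floor x') (- Num.floor y') x y tf).
rewrite -(torus_funDint (- Num.floor x') (- Num.floor y') x' y' tf).
have h (t : R) : 0 <= t + (- Num.floor t)%:~R <= 1.
  have /andP[t1 t2] := floor_itv t; rewrite intrD in t2.
  by rewrite rmorphN/=; apply/andP; split; lra.
apply: Pd; rewrite ?addrKA//=.
- by split; rewrite /= in_itv/= h.
- by rewrite [_ - _](_ : _ = x - x')//; ring.
- by rewrite [_ - _](_ : _ = y - y')//; ring.
Unshelve. all: by end_near. Qed.

Lemma sin2_piDint (x : R) (m : int) : sin (pi * (x + m%:~R)) ^+ 2 = sin (pi * x) ^+ 2.
Proof.
have H (y : R) : sin y ^+ 2 = (1 - cos (2 * y)) / 2.
  by rewrite mulr_natl cos_mulr2n cos2sin2; lra.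
rewrite !H; congr ((1 - _) / 2).
by rewrite -[RHS](cosDint _ m); congr cos; ring.
Qed.

Lemma sin2_pi_ge (d x : R) : 0 < d -> d <= `|x| -> `|x| <= 2^-1 ->
  sin (pi * d) ^+ 2 <= sin (pi * x) ^+ 2.
Proof.
move=> d0 dx x2; have pi0 := @pi_gt0 R.
have -> : sin (pi * x) ^+ 2 = sin (pi * `|x|) ^+ 2.
  by case: (ler0P x) => _ //; rewrite mulrN sinN sqrrN.
have I (t : R) : 0 < t -> t <= 2^-1 -> pi * t \in `[- (pi / 2), pi / 2].
  by move=> t0 t2; rewrite in_itv/=; apply/andP; split; nra.
have s0 : 0 <= sin (pi * d).
  by rewrite sin_ge0_pi// mulr_ge0 ?ltW//= ; nra.
have M : sin (pi * d) <= sin (pi * `|x|).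
  have [<-//|dx'] := eqVneq d `|x|; have {}dx : d < `|x| by rewrite lt_neqAle dx'.
  apply: ltW; rewrite ltr_sin; first by rewrite ltr_pM2l.
    by apply: I; lra.
  by apply: I; lra.
by rewrite ler_sqr// nnegrE// (le_trans s0).
Qed.

(* Bernstein-style modulus: the squared sines are exactly what the Fejer kernel
   kills in [sin2_fejer]. *)
Lemma torus_fun_modulus (f : R * R -> R) (e : R) : torus_fun f -> 0 < e ->
  exists2 K : R, 0 <= K & forall x y x' y', `|f (x, y) - f (x', y')| <=
    e + K * (sin (pi * (x - x')) ^+ 2 + sin (pi * (y - y')) ^+ 2).
Proof.
move=> tf e0; have [B B0 fB] := torus_fun_bounded tf.
have [d' d'0 fd'] := torus_fun_unif_continuous tf e0.
pose d := Num.min d' 2^-1.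
have d0 : 0 < d by rewrite lt_min d'0 invr_gt0 ltr0n.
have dd' : d <= d' by rewrite ge_min lexx.
have d2 : d <= 2^-1 by rewrite ge_min lexx orbT.
pose s := sin (pi * d) ^+ 2.
have s0 : 0 < s.
  rewrite exprn_gt0// sin_gt0_pi//; have := @pi_gt0 R; nra.
(* With this constant, a single difference of size between [d] and [1 / 2] makes the sine term at
   least [2 * B], the largest possible oscillation of [f]. *)
have K0 : 0 <= 2 * B / s by apply: divr_ge0 (ltW s0); exact: mulr_ge0.
exists (2 * B / s) => // x y x' y'.
have R1 (t : R) : exists m : int, `|t + m%:~R| <= 2^-1.
  exists (- Num.floor (t + 2^-1)).
  have /andP[t1 t2] := floor_itv (t + 2^-1); rewrite intrD in t2.
  by rewrite rmorphN/= ler_norml; apply/andP; split; lra.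
have [m Hm] := R1 (x - x'); have [n Hn] := R1 (y - y').
rewrite -(torus_funDint m n x y tf) -(sin2_piDint _ m) -(sin2_piDint (y - y') n).
set a := x - x' + m%:~R in Hm *; set b := y - y' + n%:~R in Hn *.
have Ea : x + m%:~R - x' = a by rewrite /a; ring.
have Eb : y + n%:~R - y' = b by rewrite /b; ring.
have big : `|f (x + m%:~R, y + n%:~R) - f (x', y')| <= 2 * B.
  by rewrite (le_trans (ler_normB _ _))// mulr_natl mulr2n lerD.
have [ad|da] := ltP `|a| d; last first.
  rewrite (le_trans big)//.
  have : s <= sin (pi * a) ^+ 2 by exact: sin2_pi_ge.
  have := sqr_ge0 (sin (pi * b)) => h1 h2.
  apply: (@le_trans _ _ (2 * B / s * s)); first by rewrite divfK// gt_eqF.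
  rewrite -[leLHS]add0r; apply: lerD (ltW e0) _.
  by rewrite ler_wpM2l//; lra.
have [bd|db] := ltP `|b| d; last first.
  rewrite (le_trans big)//.
  have : s <= sin (pi * b) ^+ 2 by exact: sin2_pi_ge.
  have := sqr_ge0 (sin (pi * a)) => h1 h2.
  apply: (@le_trans _ _ (2 * B / s * s)); first by rewrite divfK// gt_eqF.
  rewrite -[leLHS]add0r; apply: lerD (ltW e0) _.
  by rewrite ler_wpM2l//; lra.
apply: (@le_trans _ _ e).
  by apply: fd'; rewrite ?Ea ?Eb (lt_le_trans _ dd').
by rewrite lerDl mulr_ge0// addr_ge0 ?sqr_ge0.
Qed.

(** Samples of [f] on a grid are averaged with products of Fejer kernels. These weights are
    nonnegative with sum 1, so the error is an average of the modulus of continuity, whose sine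
    squares the kernel makes small. *)
Lemma torus_fun_trig_approx (f : R * R -> R) (e : R) : torus_fun f -> 0 < e ->
  exists2 g, trig_poly g & forall z, `|f z - g z| <= e.
Proof.
move=> tf e0; have e2 : 0 < e / 2 by rewrite divr_gt0.
have [K K0 fK] := torus_fun_modulus tf e2.
(* Each coordinate contributes an error of at most [K / M]; the two together must stay below
   [e / 2]. *)
pose M := (Num.truncn (4 * K / e)).+1.
have M0 : 0 < M%:R :> R by rewrite ltr0n.
have KM : 2 * K / M%:R <= e / 2.
  rewrite ler_pdivrMr//.
  have : 4 * K / e <= M%:R by rewrite ltW// truncnS_gt.
  by rewrite ler_pdivrMr//; lra.
pose p (a : 'I_M) : R := a%:R / M%:R.
exists (fun z => \sum_(a < M) \sum_(b < M)
   f (p a, p b) * (fejer M (z.1 - p a) * fejer M (z.2 - p b))).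
  apply: trig_poly_sum => a; apply: trig_poly_sum => b; apply: trig_polyZ.
  by apply: trig_polyM; [exact: trig_poly_fejer1|exact: trig_poly_fejer2].
move=> [x y] /=.
have S1 (t : R) : \sum_(a < M) fejer M (t - p a) = 1 by exact: sum_fejer_grid.
have S2 (t : R) : \sum_(a < M) sin (pi * (t - p a)) ^+ 2 * fejer M (t - p a) <= M%:R^-1.
  apply: (@le_trans _ _ (\sum_(a < M) (M%:R ^+ 2)^-1)).
    by apply: ler_sum => a _; exact: sin2_fejer.
  rewrite sumr_const card_ord -[leLHS]mulr_natl expr2 invfM mulrA mulfV ?mul1r//.
  by rewrite gt_eqF.
rewrite [f (x, y)](_ : _ = \sum_(a < M) \sum_(b < M)
   f (x, y) * (fejer M (x - p a) * fejer M (y - p b))); last first.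
  under eq_bigr => a _ do rewrite -big_distrr/= -big_distrr/= S1 mulr1.
  by rewrite -big_distrr/= S1 mulr1.
rewrite -sumrB; under eq_bigr => a _ do rewrite -sumrB.
pose W a b := fejer M (x - p a) * fejer M (y - p b).
have W0 a b : 0 <= W a b by rewrite mulr_ge0// fejer_ge0.
apply: (@le_trans _ _ (\sum_(a < M) \sum_(b < M)
  (e / 2 + K * (sin (pi * (x - p a)) ^+ 2 + sin (pi * (y - p b)) ^+ 2)) * W a b)).
  rewrite (le_trans (ler_norm_sum _ _ _))//; apply: ler_sum => a _.
  rewrite (le_trans (ler_norm_sum _ _ _))//; apply: ler_sum => b _.
  by rewrite -mulrBl normrM (ger0_norm (W0 a b)) ler_wpM2r.
have E a b : (e / 2 + K * (sin (pi * (x - p a)) ^+ 2 + sin (pi * (y - p b)) ^+ 2)) * W a b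
  = e / 2 * fejer M (x - p a) * fejer M (y - p b)
  + K * (sin (pi * (x - p a)) ^+ 2 * fejer M (x - p a)) * fejer M (y - p b)
  + K * fejer M (x - p a) * (sin (pi * (y - p b)) ^+ 2 * fejer M (y - p b)).
  by rewrite /W; ring.
under eq_bigr => a _.
  under eq_bigr => b _ do rewrite E.
  rewrite !big_split/= -!big_distrr/= S1 !mulr1.
over.
rewrite !big_split/= -!big_distrr/= S1 mulr1 -big_distrl/= -big_distrr/= S1 mulr1.
have := S2 x; have := S2 y => h1 h2.
set s1 := \sum_(i < M) _ in h1 *; set s2 := \sum_(i < M) _ in h2 *.
have : K * s1 <= K * M%:R^-1 by rewrite ler_wpM2l.
have : K * s2 <= K * M%:R^-1 by rewrite ler_wpM2l.
lra.
Qed.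

End torus_approximation.

(** * Sets of density zero and their complements *)

Section density.
Context {R : realType}.
Notation lam := (@lebesgue_measure R).

(** Multiplying out the quotient by [T] keeps the bound in the extended reals, where it also yields
    finiteness of the measure. *)
Definition density_zero (B : set R) := forall e : R, 0 < e ->
  exists M : R, forall T, M <= T -> (lam (B `&` `[0%R, T]) <= (e * T)%:E)%E.

Lemma density_zero0 : density_zero set0.
Proof.
move=> e e0; exists 0 => T T0; rewrite set0I measure0 lee_fin.
by rewrite mulr_ge0// ltW.
Qed.

Lemma density_zeroU (A B : set R) : measurable A -> measurable B ->
  density_zero A -> density_zero B -> density_zero (A `|` B).
Proof.
move=> mA mB dA dB e e0; have e2 : 0 < e / 2 by rewrite divr_gt0.
have [M HM] := dA _ e2; have [N HN] := dB _ e2.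
exists (Num.max M N) => T; rewrite ge_max => /andP[MT NT].
rewrite setIUl (le_trans (measureU2 _ _ _))//; try exact: measurableI.
rewrite [in leRHS](splitr e) mulrDl EFinD.
by apply: leeD; [exact: HM|exact: HN].
Qed.

(* [E] is the union of the sets [B 0 `|` .. `|` B n.-1] cut off below [M n]; below a
   time [T] it is contained in the single such set of largest index with [M n <= T]. *)
Lemma density_zero_diagonal (B : nat -> set R) : (forall n, measurable (B n)) ->
  (forall n, density_zero (B n)) ->
  exists E : set R, [/\ measurable E, density_zero E &
    forall n, exists M : R, forall t, M <= t -> B n t -> E t].
Proof.
move=> mB dB; pose B' n := \big[setU/set0]_(i < n) B i.
have mB' n : measurable (B' n) by exact: bigsetU_measurable.
have dB' n : density_zero (B' n).
  rewrite /B'; elim: n => [|n IH]; first by rewrite big_ord0; exact: density_zero0.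
  by rewrite big_ord_recr/=; apply: density_zeroU => //; exact: mB'.
(* The requirement [n <= M n] leaves only finitely many [n] with [M n <= T], so that a largest one
   exists. *)
have /choice[M HM] : forall n, exists M : R, n%:R <= M /\ forall T, M <= T ->
    (lam (B' n `&` `[0%R, T]) <= (n.+1%:R^-1 * T)%:E)%E.
  move=> n; have n0 : 0 < n.+1%:R^-1 :> R by rewrite invr_gt0.
  have [M HM] := dB' n _ n0.
  exists (Num.max M n%:R); split; first by rewrite le_max lexx orbT.
  by move=> T; rewrite ge_max => /andP[MT _]; exact: HM.
exists (\bigcup_n (B' n `&` [set` `[M n, +oo[])); split.
- by apply: bigcup_measurable => n _; exact: measurableI.
- move=> e e0; pose N := Num.truncn (e^-1).
  have Ne : N.+1%:R^-1 <= e.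
    by rewrite invf_ple ?posrE// ltW// truncnS_gt.
  exists (M N) => T MT.
  have T0 : 0 <= T by rewrite (le_trans _ MT)// (le_trans _ (HM N).1).
  have exT : exists n, M n <= T by exists N.
  have ubT n : M n <= T -> (n <= Num.truncn T)%N.
    by move=> MnT; rewrite truncn_ge_nat//; exact: le_trans (HM n).1 MnT.
  case: (ex_maxnP exT ubT) => m MmT mmax.
  apply: (@le_trans _ _ (lam (B' m `&` `[0%R, T]))).
    apply: le_measure; rewrite ?inE.
    + apply: measurableI => //.
      by apply: bigcup_measurable => n _; apply: measurableI; [exact: mB'|exact: measurable_itv].
    + by apply: measurableI; [exact: mB'|exact: measurable_itv].
    + move=> t [[n _ [B't]]]; rewrite /= !in_itv/= andbT => Mnt /andP[t0 tT].
      split; last by rewrite t0.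
      have nm : (n <= m)%N by apply: mmax; exact: le_trans tT.
      exact: (subset_bigsetU nm).
  rewrite (le_trans ((HM m).2 _ MmT))// lee_fin ler_wpM2r//.
  by rewrite (le_trans _ Ne)// lef_pV2 ?posrE// ler_nat ltnS mmax.
- move=> n; exists (M n.+1) => t Mt Bt; exists n.+1 => //; split.
    by rewrite /B' big_ord_recr/=; right.
  by rewrite /= in_itv/= andbT.
Qed.

Lemma density_one_setC (E : set R) : measurable E -> density_zero E ->
  fine (lam ((`[0, +oo[ `\` E) `&` `[0, T])) / T @[T --> +oo] --> (1 : R).
Proof.
move=> mE dE; apply/cvgrPdist_le => e e0.
have [M HM] := dE _ e0.
near=> T.
have MT : M <= T by near: T; apply: nbhs_pinfty_ge; exact: num_real.
have T0 : 0 < T by near: T; apply: nbhs_pinfty_gt; exact: num_real.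
have lT : lam `[0, T] = T%:E by rewrite lebesgue_measure_itv/= lte_fin T0 -EFinB subr0.
have fE : lam (E `&` `[0, T]) \is a fin_num.
  by rewrite ge0_fin_numE// (le_lt_trans (HM _ MT))// ltry.
rewrite (_ : _ `&` _ = `[0, T] `\` (E `&` `[0, T])); last first.
  apply/seteqP; split => t /=; rewrite !in_itv/= andbT.
    by move=> [[t0 Et] t0T]; split => // -[].
  move=> [/andP[t0 tT] Et]; split; last exact/andP.
  by split => // Et'; apply: Et; split => //; exact/andP.
rewrite measureD//=; [|exact: measurableI|by rewrite lT ltry].
rewrite (_ : `[0, T] `&` (E `&` `[0, T]) = E `&` `[0, T]); last first.
  by rewrite setIC -setIA setIid.
rewrite lT -(fineK fE) /= mulrBl divff ?gt_eqF// opprB addrCA subrr addr0.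
rewrite ger0_norm; last by rewrite divr_ge0 ?fine_ge0// ltW.
rewrite ler_pdivrMr//.
have := HM _ MT; rewrite -(fineK fE) lee_fin//.
Unshelve. all: by end_near. Qed.

End density.

(** * Smallness of the Fourier transform of [c] outside density zero *)

Section weak_convergence.
Context {R : realType}.
Notation lam := (@lebesgue_measure R).
Notation c := (@digit_map R).
Notation C := (char_cos c).
Notation S := (char_sin c).

Let mc := @measurable_digit_map R.

Definition large_char (g d : R) : set R := [set t | d < C (g * t) ^+ 2 + S (g * t) ^+ 2].

Let mH (g : R) : measurable_fun setT (fun t => C (g * t) ^+ 2 + S (g * t) ^+ 2).
Proof.
apply: measurable_funD; apply: (measurableT_comp (f := fun x : R => x ^+ 2)) => //.
- by apply: measurableT_comp; [exact: measurable_char_cos|exact: measurable_funM].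
- by apply: measurableT_comp; [exact: measurable_char_sin|exact: measurable_funM].
Qed.

Lemma measurable_large_char g d : measurable (large_char g d).
Proof.
rewrite (_ : large_char g d = (fun t => C (g * t) ^+ 2 + S (g * t) ^+ 2) @^-1` `]d, +oo[).
  by rewrite -[X in measurable X]setTI; exact: mH.
by apply/seteqP; split => t /=; rewrite in_itv/= andbT.
Qed.

(** Chebyshev's inequality applied to the mean square bound, with the gap [2 ^- k] and the
    separation [1 / q k] of [c]. *)
Lemma density_zero_large_char (g d : R) : g != 0 -> 0 < d -> density_zero (large_char g d).
Proof.
move=> g0 d0 e e0.
have combine (I A K X Y : R) :
  X <= I -> I <= A + K -> 2 * K <= Y -> A <= Y / 2 -> X <= Y by lra.
(* This [k] makes the diagonal term at most [d e T / 2]; the lower bound imposed on [T] further down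
   absorbs the constant off-diagonal term in the other half. *)
pose k := Num.truncn (4 / (d * e)).
have de : 0 < d * e by rewrite mulr_gt0.
have k2 : 2 * 2 ^- k <= d * e / 2.
  have : 4 / (d * e) <= 2 ^+ k.
    rewrite (le_trans (ltW (truncnS_gt _)))// -natrX ler_nat.
    exact: ltn_expl.
  rewrite ler_pdivrMr// => h; rewrite -/k.
  by rewrite -[2 ^- k]mul1r mulrA ler_pdivrMr ?exprn_gt0//; lra.
set q : R := (scale_seq k)%:R; have q0 : 0 < q by exact: scale_seq_gt0.
have gp : 0 < `|g| by rewrite normr_gt0.
exists (Num.max 1 (2 * (2 / (`|g| * q^-1)) / (d * e))) => T.
rewrite ge_max => /andP[T1 TM]; have T0 : 0 < T by lra.
have lT : lam `[0, T] = T%:E by rewrite lebesgue_measure_itv/= lte_fin T0 -EFinB subr0.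
have fT : (lam `[0%R, T] < +oo)%E by rewrite lT ltry.
have mB := measurable_large_char g d.
have fin : lam (large_char g d `&` `[0, T]) \is a fin_num.
  rewrite ge0_fin_numE// (le_lt_trans _ fT)// le_measure ?inE//.
  exact: measurableI.
have H2 (t : R) : `|C (g * t) ^+ 2 + S (g * t) ^+ 2| <= 2.
  rewrite (le_trans (ler_normD _ _))// !normrX.
  have := char_cos_le1 mc (g * t); have := char_sin_le1 mc (g * t).
  have := normr_ge0 (C (g * t)); have := normr_ge0 (S (g * t)).
  set x := `|C _|; set y := `|S _|; nra.
have ms := @mean_square_bound R c mc (2 ^- k) q^-1 g T.
have {ms} : \int[lam]_(t in `[0, T]) (C (g * t) ^+ 2 + S (g * t) ^+ 2)
    <= 2 * 2 ^- k * T + 2 / (`|g| * q^-1).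
  apply: ms => //; rewrite ?invr_gt0 ?exprn_gt0//.
  by move=> u v u0 v1 uv; apply: digit_map_sep uv; exact: ltW.
have : d * fine (lam (large_char g d `&` `[0, T])) <=
    \int[lam]_(t in `[0, T]) (C (g * t) ^+ 2 + S (g * t) ^+ 2).
  have -> : fine (lam (large_char g d `&` `[0, T])) =
      \int[lam]_(t in `[0, T]) \1_(large_char g d) t.
    by rewrite /Rintegral integral_indic.
  have i1 : lam.-integrable `[0, T] (EFin \o (\1_(large_char g d) : R -> R)).
    apply: (@bounded_integrable R _ _ lam `[0, T] _ 1) => //.
    by move=> u _; rewrite indicE; case: (_ \in _); rewrite ?normr0 ?normr1.
  rewrite -RintegralZl//; apply: le_Rintegral => //.
  - exact: integrable_scale.
  - apply: (@bounded_integrable R _ _ lam `[0, T] _ 2) => //.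
    exact: measurable_funTS (mH g).
  - move=> t _; rewrite indicE; case: (boolP (t \in _)) => [|_].
      by rewrite inE mulr1 => /ltW.
    by rewrite mulr0 addr_ge0 ?sqr_ge0.
rewrite -(fineK fin) lee_fin.
set b := fine _; move=> h1 h2.
have h3 : 2 * (2 / (`|g| * q^-1)) <= T * (d * e) by rewrite -ler_pdivrMr.
have h4 : 2 * 2 ^- k * T <= d * e / 2 * T by rewrite ler_wpM2r// ltW.
have h4' : 2 * 2 ^- k * T <= T * (d * e) / 2 by rewrite (le_trans h4)// mulrAC (mulrC T).
have := combine _ _ _ _ _ h1 h2 h3 h4'.
by rewrite [T * _]mulrC -mulrA ler_pM2l.
Qed.

End weak_convergence.

(** * Weak equidistribution along the curve, and failure of equidistribution *)

Section assembly.
Context {R : realType}.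
Notation lam := (@lebesgue_measure R).
Notation c := (@digit_map R).
Notation C := (char_cos c).
Notation S := (char_sin c).

Let mc := @measurable_digit_map R.

Definition digit_curve (u : R) : R * R := (c u, pi * c u).

(** Along the curve, the character [(m, n)] at time [t] has phase [freq m n * t * c u], up to the
    contribution of the base point. *)
Definition freq (m n : int) : R := 2 * pi * (m%:~R + n%:~R * pi).

(** For [n != 0], a vanishing frequency would make [pi] the rational number [- m / n]. *)
Lemma freq_neq0 (m n : int) : (m != 0) || (n != 0) -> freq m n != 0.
Proof.
move=> mn; have pi0 := @pi_gt0 R.
rewrite /freq mulf_neq0//; first by rewrite gt_eqF// mulr_gt0.
apply/eqP => E; have [n0|n0] := eqVneq n 0.
  by move: mn E; rewrite n0 eqxx orbF mul0r addr0 => m0 /eqP; rewrite intr_eq0 (negbTE m0).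
apply: (@pi_irrationnal R); exists (- m%:~R / n%:~R) => //.
rewrite fmorph_div rmorphN/= !ratr_int; apply: (mulIf (x := n%:~R)).
  by rewrite intr_eq0.
rewrite divfK ?intr_eq0//; lra.
Qed.

Definition bounded_measurable (f : R * R -> R) :=
  measurable_fun setT f /\ exists M : R, forall z, `|f z| <= M.

Lemma trig_poly_bounded_measurable f : trig_poly f -> bounded_measurable f.
Proof.
elim=> [m n th|g h _ [mg [M gM]] _ [mh [N hN]]|a g _ [mg [M gM]]].
- split; last by exists 1 => z; exact: cos_max.
  apply: measurableT_comp; first exact: measurable_cos.
  apply: measurable_funD => //; apply: measurable_funM => //.
  by apply: measurable_funD; exact: measurable_funM.
- split; first exact: measurable_funD.
  by exists (M + N) => z; rewrite (le_trans (ler_normD _ _))// lerD.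
- split; first exact: measurable_funM.
  by exists (`|a| * M) => z; rewrite normrM ler_wpM2l.
Qed.

(** Measurability for the product sigma-algebra comes from being a pointwise limit of trigonometric
    polynomials, which are visibly measurable. *)
Lemma torus_fun_bounded_measurable f : torus_fun f -> bounded_measurable f.
Proof.
move=> tf; split; last by have [B _ fB] := torus_fun_bounded tf; exists B.
have /choice[g Hg] : forall n : nat, exists g, trig_poly g /\
    forall z, `|f z - g z| <= n.+1%:R^-1.
  move=> n; have n0 : 0 < n.+1%:R^-1 :> R by rewrite invr_gt0.
  by have [g tg fg] := torus_fun_trig_approx tf n0; exists g.
apply: (measurable_fun_cvg (h := g)).
  by move=> n; exact: (trig_poly_bounded_measurable (Hg n).1).1.
move=> z _; apply/cvgrPdist_le => e e0; near=> n.
rewrite (le_trans ((Hg n).2 z))//.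
have ne : e^-1 <= n.+1%:R.
  rewrite (@le_trans _ _ n%:R) ?ler_nat//; near: n.
  exact: nbhs_infty_ger.
by rewrite invf_ple ?posrE.
Unshelve. all: by end_near. Qed.

Section normalized.
Context d (T : measurableType d) (m : {measure set T -> \bar R}) (D : set T).
Hypotheses (mD : measurable D) (m1 : m D = 1%E).
Implicit Types f g : T -> R.

Let fD : (m D < +oo)%E. Proof. by rewrite m1 ltry. Qed.

Lemma Rintegral_dist f g (M N e : R) :
  measurable_fun D f -> measurable_fun D g ->
  (forall x, D x -> `|f x| <= M) -> (forall x, D x -> `|g x| <= N) ->
  (forall x, D x -> `|f x - g x| <= e) ->
  `|\int[m]_(x in D) f x - \int[m]_(x in D) g x| <= e.
Proof.
move=> mf mg fM gN fg.
rewrite -RintegralB//; [|exact: bounded_integrable fM|exact: bounded_integrable gN].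
rewrite -[leRHS]mulr1 -[X in _ * X]/(fine 1%E) -m1.
by apply: Rintegral_le_bound => //; exact: measurable_funB.
Qed.

End normalized.

Notation U := (`]0%R, 1%R[%classic : set R).
Notation J := (`[0%R, 1%R[%classic : set R).

Let lamU : lam U = 1%E.
Proof. by rewrite lebesgue_measure_itv/= lte_fin ltr01 -EFinB subr0. Qed.

Let lamJ : lam J = 1%E.
Proof. by rewrite lebesgue_measure_itv/= lte_fin ltr01 -EFinB subr0. Qed.

Let fJ : (lam J < +oo)%E.
Proof. by rewrite lamJ ltry. Qed.

Let lamJJ : (lam \x lam)%E (J `*` J) = 1%E.
Proof.
rewrite product_measure1E; [|exact: measurable_itv..].
by rewrite [X in (X * _)%E]lamJ [X in (_ * X)%E]lamJ mule1.
Qed.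

Let mJJ : measurable (J `*` J).
Proof. by apply: measurableX; exact: measurable_itv. Qed.

Let fJJ : ((lam \x lam)%E (J `*` J) < +oo)%E.
Proof. by rewrite lamJJ ltry. Qed.

Let fU : (lam U < +oo)%E.
Proof. by rewrite lamU ltry. Qed.

(** * Linearity and contraction of the integrals against [mu_t] and Haar measure *)

Section integration_functionals.
Variables (x0 : R * R) (t : R).
Implicit Types f g : R * R -> R.

Let shift (u : R) : R * R := (t * (digit_curve u).1 + x0.1, t * (digit_curve u).2 + x0.2).

Let mshift f : measurable_fun setT f -> measurable_fun setT (f \o shift).
Proof.
move=> mf; apply: measurableT_comp => //; apply/measurable_fun_pairP; split.
- by apply: measurable_funD => //; exact: measurable_funM.
- apply: measurable_funD => //; apply: measurable_funM => //.
  exact: measurable_funM.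
Qed.

Let imu f : bounded_measurable f -> lam.-integrable U (EFin \o (f \o shift)).
Proof.
move=> [mf [M fM]]; apply: (@bounded_integrable R _ _ lam U _ M) => //.
  exact: measurable_funTS (mshift mf).
by move=> x _; exact: fM.
Qed.

Let ihaar f : bounded_measurable f -> (lam \x lam)%E.-integrable (J `*` J) (EFin \o f).
Proof.
move=> [mf [M fM]].
apply: (@bounded_integrable R _ _ (lam \x lam)%E (J `*` J) _ M) => //.
exact: measurable_funTS mf.
Qed.

Lemma mu_t_intD f g : bounded_measurable f -> bounded_measurable g ->
  mu_t_int digit_curve x0 t (fun z => f z + g z)
  = mu_t_int digit_curve x0 t f + mu_t_int digit_curve x0 t g.
Proof.
move=> bf bg.
by apply: (@RintegralD _ _ _ lam U (f \o shift) (g \o shift)) => //; exact: imu.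
Qed.

Lemma mu_t_intZ a f : bounded_measurable f ->
  mu_t_int digit_curve x0 t (fun z => a * f z) = a * mu_t_int digit_curve x0 t f.
Proof. by move=> bf; apply: (@RintegralZl _ _ _ lam U (f \o shift)) => //; exact: imu. Qed.

Lemma haar_intD f g : bounded_measurable f -> bounded_measurable g ->
  haar_int (fun z => f z + g z) = haar_int f + haar_int g.
Proof.
move=> bf bg.
by apply: (@RintegralD _ _ _ (lam \x lam)%E (J `*` J) f g) => //; exact: ihaar.
Qed.

Lemma haar_intZ a f : bounded_measurable f ->
  haar_int (fun z => a * f z) = a * haar_int f.
Proof.
move=> bf.
by apply: (@RintegralZl _ _ _ (lam \x lam)%E (J `*` J) f) => //; exact: ihaar.
Qed.

Lemma mu_t_int_dist f g e : bounded_measurable f -> bounded_measurable g ->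
  (forall z, `|f z - g z| <= e) ->
  `|mu_t_int digit_curve x0 t f - mu_t_int digit_curve x0 t g| <= e.
Proof.
move=> [mf [M fM]] [mg [N gN]] fg.
apply: (@Rintegral_dist _ _ lam U _ lamU (f \o shift) (g \o shift) M N) => //.
- exact: measurable_funTS (mshift mf).
- exact: measurable_funTS (mshift mg).
- by move=> u _; exact: fM.
- by move=> u _; exact: gN.
- by move=> u _; exact: fg.
Qed.

Lemma haar_int_dist f g e : bounded_measurable f -> bounded_measurable g ->
  (forall z, `|f z - g z| <= e) -> `|haar_int f - haar_int g| <= e.
Proof.
move=> [mf [M fM]] [mg [N gN]] fg.
apply: (@Rintegral_dist _ _ (lam \x lam)%E (J `*` J) _ lamJJ f g M N) => //.
- exact: measurable_funTS mf.
- exact: measurable_funTS mg.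
Qed.

Lemma mu_t_int_cos (m n : int) th (a := 2 * pi * (m%:~R * x0.1 + n%:~R * x0.2) + th) :
  mu_t_int digit_curve x0 t (fun z => cos (2 * pi * (m%:~R * z.1 + n%:~R * z.2) + th))
  = cos a * C (freq m n * t) - sin a * S (freq m n * t).
Proof.
rewrite -(Rintegral_cos_phase mc); apply: eq_Rintegral => u _; congr cos.
by rewrite /a /freq /=; ring.
Qed.

End integration_functionals.

Lemma Rintegral_cos_period (n : int) th : n != 0 ->
  \int[lam]_(y in J) cos (2 * pi * n%:~R * y + th) = 0.
Proof.
move=> n0; rewrite Rintegral_itv_bndo_bndc; last first.
  apply: (@bounded_integrable R _ _ lam J _ 1) => //.
  - apply: measurable_funTS; apply: measurableT_comp; first exact: measurable_cos.
    by apply: measurable_funD => //; exact: measurable_funM.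
  - by move=> x _; exact: cos_max.
rewrite Rintegral_cos//; last by rewrite !mulf_neq0 ?intr_eq0// gt_eqF// pi_gt0.
by rewrite mulr1 [_ + th]addrC sinDint subrr mul0r.
Qed.

Lemma haar_int_cos (m n : int) th :
  haar_int (fun z : R * R => cos (2 * pi * (m%:~R * z.1 + n%:~R * z.2) + th))
  = if (m == 0) && (n == 0) then cos th else 0.
Proof.
have bm := trig_poly_bounded_measurable (@trig_poly_cos R m n th).
rewrite /haar_int (@Rintegral_rectangle R _ _ _ _ lam lam J J _ 1)//; first last.
- by move=> z; exact: cos_max.
- exact: bm.1.
have [n0|n0] := eqVneq n 0; last first.
  rewrite andbF; transitivity (\int[lam]_(x in J) (0 : R)).
    apply: eq_Rintegral => x _ /=.
    rewrite -[RHS](Rintegral_cos_period (2 * pi * (m%:~R * x) + th) n0).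
    by apply: eq_Rintegral => y _; congr cos; ring.
  by rewrite Rintegral_cst// mul0r.
rewrite n0 andbT; transitivity (\int[lam]_(x in J) cos (2 * pi * m%:~R * x + th)).
  apply: eq_Rintegral => x _ /=.
  transitivity (\int[lam]_(y in J) cos (2 * pi * m%:~R * x + th)).
    by apply: eq_Rintegral => y _; congr cos; ring.
  by rewrite Rintegral_cst// [fine _](congr1 fine lamJ) mulr1.
have [m0|m0] := eqVneq m 0; last exact: Rintegral_cos_period.
transitivity (\int[lam]_(y in J) cos th).
  by apply: eq_Rintegral => y _; rewrite m0 mulr0 mul0r add0r.
by rewrite Rintegral_cst// [fine _](congr1 fine lamJ) mulr1.
Qed.

(** The base point is absent because it only changes the phase in [mu_t_int_cos]; one set [A]
    therefore serves every [x0]. *)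
Definition char_vanishing (A : set R) := forall m n : int, (m != 0) || (n != 0) ->
  forall d : R, 0 < d -> exists M : R, forall t, A t -> M <= t ->
    C (freq m n * t) ^+ 2 + S (freq m n * t) ^+ 2 <= d.

Lemma trig_poly_cvg_along A x0 f : char_vanishing A -> trig_poly f ->
  cvg_along A (fun t => mu_t_int digit_curve x0 t f) (haar_int f).
Proof.
move=> vA; elim=> [m n th|g h tg IHg th IHh|a g tg IHg] e e0.
- rewrite haar_int_cos; case: (boolP (_ && _)) => [/andP[/eqP-> /eqP->]|].
    (* For the trivial character both integrals equal [cos th] at every time. *)
    exists 0 => t _ _; rewrite mu_t_int_cos /freq !mul0r !(addr0, mulr0, mul0r, add0r).
    have -> : C 0 = 1.
      rewrite /char_cos; transitivity (\int[lam]_(u in U) (1 : R)).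
        by apply: eq_Rintegral => u _; rewrite mul0r cos0.
      by rewrite Rintegral_cst// [fine _](congr1 fine lamU) mulr1.
    have -> : S 0 = 0.
      rewrite /char_sin; transitivity (\int[lam]_(u in U) (0 : R)).
        by apply: eq_Rintegral => u _; rewrite mul0r sin0.
      by rewrite Rintegral_cst// mul0r.
    by rewrite mulr1 mulr0 subr0 subrr normr0.
  rewrite negb_and => mn.
  (* This bound on the squared modulus gives [|C|] and [|S|] at most [e / 3], so the integral is at
     most [2 e / 3] in absolute value. *)
  have e3 : 0 < (e / 3) ^+ 2 by rewrite exprn_gt0// divr_gt0.
  have [M HM] := vA m n mn _ e3; exists M => t At Mt.
  rewrite subr0 mu_t_int_cos.
  have small (x y : R) : x ^+ 2 + y ^+ 2 <= (e / 3) ^+ 2 -> `|x| <= e / 3.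
    move=> xy; rewrite -ler_sqr ?nnegrE//; last by rewrite divr_ge0// ltW.
    by rewrite real_normK ?num_real// (le_trans _ xy)// lerDl sqr_ge0.
  have CS := HM t At Mt.
  have h1 := small _ _ CS; have h2 : `|S (freq m n * t)| <= e / 3.
    by apply: (small _ (C (freq m n * t))); rewrite addrC.
  rewrite (le_lt_trans (ler_normB _ _))// !normrM.
  apply: (@le_lt_trans _ _ (1 * (e / 3) + 1 * (e / 3))); last by lra.
  by rewrite lerD// ler_pM// ?cos_max ?sin_max.
- have bg := trig_poly_bounded_measurable tg; have bh := trig_poly_bounded_measurable th.
  have e2 : 0 < e / 2 by rewrite divr_gt0.
  have [M HM] := IHg _ e2; have [N HN] := IHh _ e2.
  exists (Num.max M N) => t At; rewrite ge_max => /andP[Mt Nt].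
  rewrite mu_t_intD// haar_intD// opprD addrACA (le_lt_trans (ler_normD _ _))//.
  by rewrite (splitr e) ltrD// ?HM ?HN.
- have bg := trig_poly_bounded_measurable tg.
  (* Adding 1 keeps the divisor positive when [a = 0]. *)
  have a1 : 0 < `|a| + 1 by rewrite ltr_wpDl.
  have [M HM] := IHg (e / (`|a| + 1)) (divr_gt0 e0 a1).
  exists M => t At Mt; rewrite mu_t_intZ// haar_intZ// -mulrBr normrM.
  have := HM t At Mt; rewrite ltr_pdivlMr// => h; apply: le_lt_trans h.
  by rewrite mulrC ler_wpM2l// lerDl.
Qed.

(** An [e / 3] argument: both functionals integrate against probability measures, so uniform
    approximation passes to the integrals, uniformly in [t]. *)
Lemma torus_fun_cvg_along A x0 f : char_vanishing A -> torus_fun f ->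
  cvg_along A (fun t => mu_t_int digit_curve x0 t f) (haar_int f).
Proof.
move=> vA tf e e0; have e3 : 0 < e / 3 by rewrite divr_gt0.
have [g tg fg] := torus_fun_trig_approx tf e3.
have bf := torus_fun_bounded_measurable tf.
have bg := trig_poly_bounded_measurable tg.
have [M HM] := trig_poly_cvg_along x0 vA tg e3.
exists M => t At Mt; have h := HM t At Mt.
have h1 := mu_t_int_dist x0 t bf bg fg; have h2 := haar_int_dist bf bg fg.
move: h h1 h2; rewrite !ltr_norml !ler_norml => /andP[a1 a2] /andP[b1 b2] /andP[c1 c2].
by apply/andP; split; lra.
Qed.

Lemma exists_char_vanishing : exists A : set R, [/\ measurable A, A `<=` `[0, +oo[,
  fine (lam (A `&` `[0, T])) / T @[T --> +oo] --> (1 : R) & char_vanishing A].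
Proof.
(* The exceptional sets, over all nontrivial characters [(m, n)] and thresholds [1 / (k + 1)], are
   enumerated by one index; codes of no such triple get the empty set. *)
pose B (i : nat) : set R := if unpickle i is Some (m, n, k) then
  if (m != 0) || (n != 0) then large_char (freq m n) (k : nat).+1%:R^-1 else set0
  else set0.
have [] := @density_zero_diagonal R B.
- move=> i; rewrite /B; case: unpickle => [[[m n] k]|//].
  by case: ifP => // _; exact: measurable_large_char.
- move=> i; rewrite /B; case: unpickle => [[[m n] k]|]; last exact: density_zero0.
  case: ifP => mn; last exact: density_zero0.
  by apply: density_zero_large_char; [exact: freq_neq0|rewrite invr_gt0].
move=> E [mE dE BE]; exists (`[0, +oo[ `\` E); split.
- exact: measurableD.
- exact: subDsetl.
- exact: density_one_setC.
move=> m n mn d d0; pose k := Num.truncn d^-1.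
have [M HM] := BE (pickle (m, n, k)); exists M => t [_ Et] Mt.
rewrite leNgt; apply/negP => big; apply: Et; apply: (HM t Mt).
rewrite /B pickleK mn /large_char/=; apply: le_lt_trans big.
by rewrite invf_ple ?posrE// ltW// truncnS_gt.
Qed.

Lemma digit_curve_weakly_equidistributed x0 : weakly_equidistributed digit_curve x0.
Proof.
have [A [mA A0 dA vA]] := exists_char_vanishing.
by exists A; split => // f tf; exact: torus_fun_cvg_along.
Qed.

(** As [q k * c u] exceeds an integer by at most [1 / 8], the phase lies within [pi / 4] of a
    multiple of [2 pi] for every [u]. *)
Lemma char_cos_scale_seq k : cos (pi / 4) <= C (2 * pi * (scale_seq k)%:R).
Proof.
have -> : cos (pi / 4) = \int[lam]_(u in U) (cos (pi / 4) : R).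
  by rewrite Rintegral_cst// [fine _](congr1 fine lamU) mulr1.
apply: le_Rintegral => //.
- by apply: (@bounded_integrable R _ _ lam U _ 1) => // u _; exact: cos_max.
- exact: integrable_cos_mulr.
move=> u; rewrite /= in_itv/= => /andP[_ /ltW u1].
have [m m0 m8] := scale_digit_map k u1.
set x := _ - m%:R in m0 m8; have pi0 := @pi_gt0 R.
have -> : 2 * pi * (scale_seq k)%:R * c u = 2 * pi * x + 2 * pi * m%:Z%:~R.
  by rewrite /x /=; ring.
have px0 : 0 <= pi * x by rewrite mulr_ge0// ltW.
have px8 : pi * x <= pi * 8^-1 by rewrite ler_pM2l.
rewrite cosDint leNgt ltr_cos ?in_itv/=; first by rewrite -leNgt; lra.
  by apply/andP; split; lra.
by apply/andP; split; lra.
Qed.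

Lemma digit_curve_not_equidistributed x0 : ~ equidistributed digit_curve x0.
Proof.
(* This phase cancels the contribution of [x0], so the integral of [f] against [mu_t] is exactly
   [C (2 pi t)]. *)
move=> eq0; pose th := - (2 * pi * (1%:~R * x0.1 + 0%:~R * x0.2)) : R.
pose f (z : R * R) := cos (2 * pi * (1%:~R * z.1 + 0%:~R * z.2) + th) : R.
have tf : torus_fun f.
  split.
    move=> z; apply: (@continuous_comp _ _ _
      (fun z : R * R => 2 * pi * (1%:~R * z.1 + 0%:~R * z.2) + th) cos).
      apply: cvgD; last exact: cvg_cst.
      apply: cvgMr; apply: cvgD; apply: cvgMr; [exact: cvg_fst|exact: cvg_snd].
    exact: continuous_cos.
  move=> z; split; rewrite /f /=.
    by rewrite -[RHS](cosDint _ 1); congr cos; ring.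
  by congr cos; ring.
have p4 : 0 < cos (pi / 4) :> R.
  by apply: cos_gt0_pihalf; have := @pi_gt0 R; lra.
(* The Haar integral of [f] is 0, so equidistribution would force [|C (2 pi t)| < cos (pi / 4)] at
   all large times, including some [t = q k]. *)
have [M HM] := eq0 f tf _ p4.
pose k := (Num.truncn M).+1.
have Mk : M <= (scale_seq k)%:R.
  by rewrite (le_trans (ltW (truncnS_gt M)))// scale_seq_ge.
have := HM (scale_seq k)%:R; rewrite /= in_itv/= ler0n => /(_ isT Mk).
rewrite haar_int_cos /= subr0 mu_t_int_cos /th subrr cos0 sin0 mul1r mul0r subr0.
rewrite /freq mul0r addr0 mulr1 ltNge => /negP; apply.
by rewrite (le_trans (char_cos_scale_seq k))// ler_norm.
Qed.

End assembly.

Theorem theorem5p3 (R : realType) :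
  exists phi : R -> R * R,
    measurable_fun (`]0, 1[ : set R) (fun u => (phi u).1) /\
    measurable_fun (`]0, 1[ : set R) (fun u => (phi u).2) /\
    forall x0 : R * R,
      weakly_equidistributed phi x0 /\ ~ equidistributed phi x0.
Proof.
exists digit_curve; split; [|split].
- exact: measurable_funTS measurable_digit_map.
- by apply: measurable_funTS; apply: measurable_funM => //; exact: measurable_digit_map.
- move=> x0; split; first exact: digit_curve_weakly_equidistributed.
  exact: digit_curve_not_equidistributed.
Qed.
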